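(* The braid group $B_n$ admits the following (reduced) group presentation: it is generated by the classical braid generators $\sigma_1,\dots,\sigma_{n-1}$ and a single clasp generator $p_1$, subject to the relations $$\begin{array}{lrcll} 1) & \sigma_i\sigma_j & = & \sigma_j\sigma_i & \text{for } |i-j|>1\\ 2) & \sigma_i\sigma_{i+1}\sigma_i & = & \sigma_{i+1}\sigma_i\sigma_{i+1} & \text{for } 1\le i\le n-2\\ 3) & p_1(\sigma_2\sigma_1\sigma_3\sigma_2)^{-1}p_1(\sigma_2\sigma_1\sigma_3\sigma_2) & = & (\sigma_2\sigma_1\sigma_3\sigma_2)^{-1}p_1(\sigma_2\sigma_1\sigma_3\sigma_2)p_1 &\\ 4) & (\sigma_2p_1\sigma_2^{-1})\sigma_1(\sigma_2p_1\sigma_2^{-1})\sigma_1 & = & \sigma_1(\sigma_2p_1\sigma_2^{-1})\sigma_1(\sigma_2p_1\sigma_2^{-1}) &\\ 5) & p_1\sigma_j & = & \sigma_jp_1 & \text{for } j>2\\ 6) & p_1\sigma_1 & = & \sigma_1p_1 &\\ 7) & p_1(\sigma_2\sigma_1)(\sigma_1\sigma_2) & = & (\sigma_2\sigma_1)(\sigma_1\sigma_2)p_1 &\\ 8) & p_1\sigma_1^{-1} & = & \sigma_1 & \end{array}$$ where relations involving some $\sigma_k$ with $k\ge n$ are omitted.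
   Context: $B_n$ ($n\ge2$) is the Artin braid group with generators $\sigma_1,\dots,\sigma_{n-1}$ and relations $\sigma_i\sigma_j=\sigma_j\sigma_i$ for $|i-j|>1$ and $\sigma_i\sigma_{i+1}\sigma_i=\sigma_{i+1}\sigma_i\sigma_{i+1}$ for $1\le i\le n-2$. The clasp generator $p_1$ corresponds to the element $\sigma_1^2\in B_n$. *)

(* Defs.v *)
From HB Require Import structures.
From mathcomp Require Import all_boot generic_quotient boolp.

Set Implicit Arguments.
Unset Strict Implicit.
Unset Printing Implicit Defensive.

Local Open Scope group_scope.

(* Words in the letters x and x^-1 (encoded as (x, false) and (x, true)).  They
   are not reduced: for concatenation and formal inversion they only form a
   monoid with involution, and x * x^-1 = 1 is imposed in pres_eq below. *)
Definition word (X : choiceType) : Type := seq (X * bool).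

HB.instance Definition _ (X : choiceType) := Choice.on (word X).

Section Words.
Variable X : choiceType.
Implicit Types (u v w : word X) (x : X).

Definition word_inv u : word X := rev [seq (a.1, ~~ a.2) | a <- u].

Fact word_mulA : associative (cat : word X -> word X -> word X).
Proof. exact: catA. Qed.

Fact word_mul1 : left_id ([::] : word X) cat.
Proof. by []. Qed.

Fact word_invK : involutive word_inv.
Proof.
move=> u; rewrite /word_inv map_rev revK -map_comp -[RHS]map_id.
by apply: eq_map => -[x b] /=; rewrite negbK.
Qed.

Fact word_invM : {morph word_inv : u v / u ++ v >-> v ++ u}.
Proof. by move=> u v; rewrite /word_inv map_cat rev_cat. Qed.

HB.instance Definition _ :=
  isStarMonoid.Build (word X) word_mulA word_mul1 word_invK word_invM.

Definition letter x : word X := [:: (x, false)].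

Variable R : word X -> word X -> Prop.

Inductive pres_eq : word X -> word X -> Prop :=
| pres_eq_rel u v : R u v -> pres_eq u v
| pres_eq_mulV u : pres_eq (u * u^-1) 1
| pres_eq_refl u : pres_eq u u
| pres_eq_sym u v : pres_eq u v -> pres_eq v u
| pres_eq_trans u v w : pres_eq u v -> pres_eq v w -> pres_eq u w
| pres_eq_mul u u' v v' :
    pres_eq u u' -> pres_eq v v' -> pres_eq (u * v) (u' * v').

Lemma pres_eq_mulVg u : pres_eq (u^-1 * u) 1.
Proof. by rewrite -[u in _ * u]invgK; exact: pres_eq_mulV. Qed.

Lemma pres_eq_inv u v : pres_eq u v -> pres_eq u^-1 v^-1.
Proof.
move=> uv; apply: (@pres_eq_trans _ (u^-1 * (v * v^-1))).
  rewrite -{1}[u^-1]mulg1; apply: pres_eq_mul; first exact: pres_eq_refl.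
  exact/pres_eq_sym/pres_eq_mulV.
rewrite mulgA -{2}[v^-1]mul1g; apply: pres_eq_mul; last exact: pres_eq_refl.
apply: pres_eq_trans (pres_eq_mulVg u); apply: pres_eq_mul.
  exact: pres_eq_refl.
exact: pres_eq_sym.
Qed.

Definition pres_eqb : rel (word X) := fun u v => `[< pres_eq u v >].

Fact pres_eqb_refl : reflexive pres_eqb.
Proof. by move=> u; apply/asboolP; exact: pres_eq_refl. Qed.

Fact pres_eqb_sym : symmetric pres_eqb.
Proof. by move=> u v; apply/asboolP/asboolP; exact: pres_eq_sym. Qed.

Fact pres_eqb_trans : transitive pres_eqb.
Proof.
move=> v u w /asboolP uv /asboolP vw; apply/asboolP; exact: pres_eq_trans uv vw.
Qed.

Canonical pres_equiv := EquivRel pres_eqb pres_eqb_refl pres_eqb_sym pres_eqb_trans.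

Definition pres_group : Type := {eq_quot pres_equiv}%qT.

HB.instance Definition _ := Choice.on pres_group.
HB.instance Definition _ := EqQuotient.on pres_group.

Definition pres_class u : pres_group := (\pi_pres_group u)%qT.

Lemma pres_classP u v : pres_class u = pres_class v <-> pres_eq u v.
Proof. by split=> [/eqmodP/asboolP|uv]; last exact/eqmodP/asboolP. Qed.

Lemma pres_class_ind (P : pres_group -> Prop) :
  (forall u, P (pres_class u)) -> forall g, P g.
Proof. by move=> Pu g; rewrite -[g]reprK; exact: Pu. Qed.

Definition pres_mul (g h : pres_group) : pres_group :=
  pres_class (repr g * repr h).

Definition pres_inv (g : pres_group) : pres_group := pres_class (repr g)^-1.

Lemma pres_eq_repr u : pres_eq (repr (pres_class u)) u.
Proof. by apply/pres_classP; exact: reprK. Qed.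

Lemma pres_class_mul u v :
  pres_mul (pres_class u) (pres_class v) = pres_class (u * v).
Proof. by apply/pres_classP/pres_eq_mul; exact: pres_eq_repr. Qed.

Lemma pres_class_inv u : pres_inv (pres_class u) = pres_class u^-1.
Proof. by apply/pres_classP/pres_eq_inv; exact: pres_eq_repr. Qed.

Fact pres_mulA : associative pres_mul.
Proof.
elim/pres_class_ind=> u; elim/pres_class_ind=> v; elim/pres_class_ind=> w.
by rewrite !pres_class_mul mulgA.
Qed.

Fact pres_mul1 : left_id (pres_class 1) pres_mul.
Proof. by elim/pres_class_ind=> u; rewrite pres_class_mul mul1g. Qed.

Fact pres_mulr1 : right_id (pres_class 1) pres_mul.
Proof. by elim/pres_class_ind=> u; rewrite pres_class_mul mulg1. Qed.

Fact pres_mulV : left_inverse (pres_class 1) pres_inv pres_mul.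
Proof.
elim/pres_class_ind=> u; rewrite pres_class_inv pres_class_mul.
by apply/pres_classP; exact: pres_eq_mulVg.
Qed.

Fact pres_mulgV : right_inverse (pres_class 1) pres_inv pres_mul.
Proof.
elim/pres_class_ind=> u; rewrite pres_class_inv pres_class_mul.
by apply/pres_classP; exact: pres_eq_mulV.
Qed.

HB.instance Definition _ := isGroup.Build pres_group
  pres_mulA pres_mul1 pres_mulr1 pres_mulV pres_mulgV.

Lemma pres_classM : {morph pres_class : u v / u * v}.
Proof. by move=> u v; rewrite -pres_class_mul. Qed.

Lemma pres_classV : {morph pres_class : u / u^-1}.
Proof. by move=> u; rewrite -pres_class_inv. Qed.

Definition pres_gen x : pres_group := pres_class (letter x).

End Words.

(* G admits the presentation < X | R >, the generator x being the element f x: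
   x |-> f x extends to an isomorphism from < X | R > onto G. *)
Definition is_presentation (G : groupType) (X : choiceType)
    (R : word X -> word X -> Prop) (f : X -> G) : Prop :=
  exists2 phi : {multiplicative pres_group R -> G},
    bijective phi & forall x, phi (pres_gen R x) = f x.

Definition braid_index (n : nat) := {k : nat | 0 < k < n}.

Definition far (i j : nat) : bool := (i.+1 < j) || (j.+1 < i).

Inductive artin_rel (n : nat) :
    word (braid_index n) -> word (braid_index n) -> Prop :=
| artin_far (i j : braid_index n) : far (val i) (val j) ->
    artin_rel (letter i * letter j) (letter j * letter i)
| artin_braid (i j : braid_index n) : val j = (val i).+1 ->
    artin_rel (letter i * letter j * letter i)
              (letter j * letter i * letter j).

Definition braid (n : nat) : groupType := pres_group (@artin_rel n).

Definition braid_sigma (n : nat) (i : braid_index n) : braid n :=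
  pres_gen (@artin_rel n) i.

(* Some i stands for sigma_i and None for the clasp generator p_1. *)
Definition clasp_index (n : nat) := option (braid_index n).

Definition sigma (n : nat) (i : braid_index n) : word (clasp_index n) :=
  letter (Some i).

Definition p1 (n : nat) : word (clasp_index n) := letter None.
Arguments p1 {n}.

(* A relation that mentions some sigma_k with k >= n is absent because there is
   then no s : braid_index n with val s = k. *)
Inductive clasp_rel (n : nat) :
    word (clasp_index n) -> word (clasp_index n) -> Prop :=
| clasp_far (i j : braid_index n) : far (val i) (val j) ->
    clasp_rel (sigma i * sigma j) (sigma j * sigma i)
| clasp_braid (i j : braid_index n) : val j = (val i).+1 ->
    clasp_rel (sigma i * sigma j * sigma i) (sigma j * sigma i * sigma j)
| clasp_p1_p3 (s1 s2 s3 : braid_index n) :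
    val s1 = 1%N -> val s2 = 2 -> val s3 = 3 ->
    clasp_rel
      (p1 * (sigma s2 * sigma s1 * sigma s3 * sigma s2)^-1
         * p1 * (sigma s2 * sigma s1 * sigma s3 * sigma s2))
      ((sigma s2 * sigma s1 * sigma s3 * sigma s2)^-1
         * p1 * (sigma s2 * sigma s1 * sigma s3 * sigma s2) * p1)
| clasp_p1_sigma12 (s1 s2 : braid_index n) :
    val s1 = 1%N -> val s2 = 2 ->
    clasp_rel
      ((sigma s2 * p1 * (sigma s2)^-1) * sigma s1
         * (sigma s2 * p1 * (sigma s2)^-1) * sigma s1)
      (sigma s1 * (sigma s2 * p1 * (sigma s2)^-1)
         * sigma s1 * (sigma s2 * p1 * (sigma s2)^-1))
| clasp_p1_far (j : braid_index n) : 2 < val j ->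
    clasp_rel (p1 * sigma j) (sigma j * p1)
| clasp_p1_sigma1 (s1 : braid_index n) : val s1 = 1%N ->
    clasp_rel (p1 * sigma s1) (sigma s1 * p1)
| clasp_p1_twist (s1 s2 : braid_index n) :
    val s1 = 1%N -> val s2 = 2 ->
    clasp_rel (p1 * (sigma s2 * sigma s1) * (sigma s1 * sigma s2))
              ((sigma s2 * sigma s1) * (sigma s1 * sigma s2) * p1)
| clasp_p1_resolve (s1 : braid_index n) : val s1 = 1%N ->
    clasp_rel (p1 * (sigma s1)^-1) (sigma s1).

Definition index1 (n : nat) (hn : 1 < n) : braid_index n := exist _ 1%N hn.

Definition clasp_val (n : nat) (hn : 1 < n) (x : clasp_index n) : braid n :=
  if x is Some i then braid_sigma i else braid_sigma (index1 hn) ^+ 2.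

(* Main.v *)
Require Import Defs.
From HB Require Import structures.
From mathcomp Require Import all_boot.

(** By relation 8 the clasp generator equals [sigma_1 ^ 2], so it can be
    eliminated by a Tietze transformation.  Relations 3-7 then have to follow
    from the Artin relations.  With [a, b, c] for [sigma_1, sigma_2, sigma_3]:
    conjugation by [b a c b] maps [a] to [c], which gives 3; and
    [b a^2 b^-1 = a^-1 b^2 a] reduces 4 to the fact that
    [b^2 a b^2 a = (b a)^3] is central in the subgroup generated by
    [a] and [b]. *)

Set Implicit Arguments.
Unset Strict Implicit.
Unset Printing Implicit Defensive.

Local Open Scope group_scope.

Section WordEval.
Variables (X : choiceType) (G : groupType) (f : X -> G).
Implicit Types u v : word X.

Definition word_eval u : G :=
  \prod_(a <- u) (if a.2 then (f a.1)^-1 else f a.1).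

Lemma word_eval_letter x : word_eval (letter x) = f x.
Proof. by rewrite /word_eval big_seq1. Qed.

Lemma word_eval1 : word_eval 1 = 1.
Proof. exact: big_nil. Qed.

Lemma word_evalM : {morph word_eval : u v / u * v}.
Proof. by move=> u v; rewrite /word_eval big_cat. Qed.

Lemma word_evalV : {morph word_eval : u / u^-1}.
Proof.
elim=> [|[x b] u IHu]; first by rewrite word_eval1 invg1.
rewrite -cat1s -[_ ++ u]/(([:: (x, b)] : word X) * u) invgM !word_evalM invgM IHu; congr (_ * _).
by rewrite /word_eval !big_seq1 /=; case: b => //=; rewrite invgK.
Qed.

Definition word_evalE := (word_evalM, word_evalV, word_eval_letter).

End WordEval.

Lemma pres_class_rel (X : choiceType) (R : word X -> word X -> Prop) u v :
  R u v -> pres_class R u = pres_class R v.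
Proof. by move=> uv; apply/pres_classP/pres_eq_rel. Qed.

Section UniversalProperty.
Variables (X : choiceType) (R : word X -> word X -> Prop) (G : groupType).

Section Lift.
Variable f : X -> G.
Hypothesis fR : forall u v, R u v -> word_eval f u = word_eval f v.

Lemma word_eval_pres_eq u v : pres_eq R u v -> word_eval f u = word_eval f v.
Proof.
elim=> {u v} [u v /fR//|u|//|//|u v w _ -> //|u u' v v' _ uu' _ vv'].
  by rewrite word_evalM word_evalV mulgV word_eval1.
by rewrite !word_evalM uu' vv'.
Qed.

(** Evaluating the chosen representative makes sense for every [f]; independence of that choice, and
    hence multiplicativity, comes from [fR]. *)
Definition pres_lift (g : pres_group R) : G := word_eval f (repr g).

Lemma pres_lift_class u : pres_lift (pres_class R u) = word_eval f u.
Proof. exact/word_eval_pres_eq/pres_eq_repr. Qed.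

Lemma pres_lift_gen x : pres_lift (pres_gen R x) = f x.
Proof. by rewrite pres_lift_class word_eval_letter. Qed.

Lemma pres_liftM : {morph pres_lift : g h / g * h}.
Proof.
elim/pres_class_ind=> u; elim/pres_class_ind=> v.
by rewrite -pres_classM !pres_lift_class word_evalM.
Qed.

End Lift.

(** Stated for bare functions so that it applies directly to a composite of lifts and to the
    identity. *)
Lemma pres_hom_ext (phi psi : pres_group R -> G) :
  {morph phi : g h / g * h} -> {morph psi : g h / g * h} ->
  (forall x, phi (pres_gen R x) = psi (pres_gen R x)) -> phi =1 psi.
Proof.
move=> phiM psiM eq_gen.
have mor1 (chi : pres_group R -> G) : {morph chi : g h / g * h} -> chi 1 = 1.
  by move=> chiM; apply: (mulgI (chi 1)); rewrite -chiM !mulg1.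
have [phi1 psi1] := (mor1 phi phiM, mor1 psi psiM).
have morV (chi : pres_group R -> G) : {morph chi : g h / g * h} ->
    {morph chi : g / g^-1}.
  by move=> chiM g; apply: (mulgI (chi g)); rewrite -chiM !mulgV mor1.
have [phiV psiV] := (morV phi phiM, morV psi psiM).
elim/pres_class_ind; elim=> [|[x b] u IHu]; first by rewrite phi1 psi1.
rewrite -cat1s -[_ ++ u]/(([:: (x, b)] : word X) * u) pres_classM phiM psiM IHu; congr (_ * _).
case: b; last exact: eq_gen.
have -> : [:: (x, true)] = (letter x)^-1 :> word X by [].
by rewrite pres_classV phiV psiV eq_gen.
Qed.

End UniversalProperty.

(** The two lifts are mutually inverse, since each composite is a homomorphism that fixes the
    generators. *)
Lemma pres_isoP (X Y : choiceType) (R : word X -> word X -> Prop)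
    (S : word Y -> word Y -> Prop)
    (f : X -> pres_group S) (g : Y -> pres_group R) :
    (forall u v, R u v -> word_eval f u = word_eval f v) ->
    (forall u v, S u v -> word_eval g u = word_eval g v) ->
    (forall x, pres_lift g (f x) = pres_gen R x) ->
    (forall y, pres_lift f (g y) = pres_gen S y) ->
  is_presentation R f.
Proof.
move=> fR gS fK gK.
have fM := pres_liftM fR; have gM := pres_liftM gS.
pose phi : pres_group R -> pres_group S := pres_lift f.
pose phiMul := isMultiplicative.Build _ _ phi fM.
pose phiHom : {multiplicative pres_group R -> pres_group S} :=
  HB.pack phi phiMul.
exists phiHom => [|x]; last exact: pres_lift_gen.
exists (pres_lift g); apply: pres_hom_ext => //=.
- by move=> u v; rewrite /phi fM gM.
- by move=> x; rewrite /phi pres_lift_gen ?fK.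
- by move=> u v; rewrite gM /phi fM.
- by move=> y; rewrite pres_lift_gen ?gK.
Qed.

Section BraidRelations.
Variables (G : groupType) (a b : G).
Hypothesis aba : a * b * a = b * a * b.

Lemma braid_conjg : a ^ b^-1 = b ^ a.
Proof.
rewrite !conjgE invgK; apply: (mulgI a); apply: (mulIg b).
by rewrite mulVKg !mulgA mulgVK aba.
Qed.

Lemma braid_commute_full_twist : commute (b ^+ 2 * a * b ^+ 2 * a) a.
Proof.
have -> : b ^+ 2 * a * b ^+ 2 * a = b * a * b * (a * b * a).
  by rewrite -!mulgA; congr (_ * _); rewrite !mulgA aba.
(* Both sides become the alternating word [a b a b a b a]. *)
by rewrite /commute -{1}aba {2}aba !mulgA.
Qed.

(** Geometrically, [b a a b] takes the third strand once around the first two, so already [a]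
    commutes with it: [a b a a b = b a b a b = b a a b a]. *)
Lemma braid_clasp_twist : commute (a ^+ 2) (b * a * (a * b)).
Proof.
apply/commute_sym/commuteX/commute_sym; rewrite /commute.
by rewrite !mulgA aba -!mulgA; do 2!congr (_ * _); rewrite !mulgA aba.
Qed.

Lemma braid_clasp_sigma12 (e := b * a ^+ 2 * b^-1) :
  e * a * e * a = a * e * a * e.
Proof.
have ae : a * e = b ^+ 2 * a.
  by rewrite [RHS]conjgC conjXg -braid_conjg -conjXg conjgE invgK /e !mulgA.
clearbody e; have aeae : a * e * a * e = b ^+ 2 * a * b ^+ 2 * a.
  by rewrite ae -mulgA ae !mulgA.
(* Multiplied by [a] on the left, the goal says that [a e a e] commutes with [a]. *)
apply: (mulgI a); rewrite aeae -braid_commute_full_twist.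
by rewrite -aeae !mulgA.
Qed.

Lemma braid_clasp_clasp c (d := b * a * c * b) :
    b * c * b = c * b * c -> commute a c ->
  commute (a ^+ 2) (d^-1 * a ^+ 2 * d).
Proof.
move=> bcb ac.
have -> : d^-1 * a ^+ 2 * d = c ^+ 2.
  rewrite -mulgA -conjgE conjXg conjgE; congr (_ ^+ 2).
  (* What remains is [a d = d c], that is, [a b a c b = b a b c b = b a c b c]. *)
  apply: (mulgI d); rewrite mulVKg /d !mulgA aba -!mulgA.
  by do 2!congr (_ * _); rewrite !mulgA.
exact: commuteX2.
Qed.

End BraidRelations.

Theorem theorem5p4 (n : nat) (hn : 1 < n) :
  is_presentation (@clasp_rel n) (clasp_val hn).
Proof.
pose s (i : braid_index n) := pres_gen (@clasp_rel n) (Some i).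
have sigma_far (i j : braid_index n) : far (val i) (val j) ->
    commute (braid_sigma i) (braid_sigma j).
  by move=> /artin_far/pres_class_rel; rewrite !pres_classM.
have sigma_braid (i j : braid_index n) : val j = (val i).+1 ->
    braid_sigma i * braid_sigma j * braid_sigma i =
    braid_sigma j * braid_sigma i * braid_sigma j.
  by move=> /artin_braid/pres_class_rel; rewrite !pres_classM.
(* The relations allow any index [s1] of value 1, whereas [clasp_val] squares the generator at
   [index1 hn]. *)
have index1E (s1 : braid_index n) : val s1 = 1%N -> index1 hn = s1.
  by move=> s1E; apply/val_inj; rewrite s1E.
have sR u v : artin_rel u v -> word_eval s u = word_eval s v.
  case=> i j ij; rewrite !word_evalE /=.
    by have /pres_class_rel := clasp_far ij; rewrite !pres_classM.
  by have /pres_class_rel := clasp_braid ij; rewrite !pres_classM.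
have valR u v : clasp_rel u v ->
    word_eval (clasp_val hn) u = word_eval (clasp_val hn) v.
  case; rewrite /sigma /p1.
  - by move=> i j ij; rewrite !word_evalE; apply: sigma_far.
  - by move=> i j ij; rewrite !word_evalE; apply: sigma_braid.
  - move=> s1 s2 s3 s1E s2E s3E; rewrite !word_evalE /= (index1E _ s1E).
    rewrite -2!mulgA [_^-1 * _]mulgA; apply: braid_clasp_clasp.
    + by apply: sigma_braid; rewrite s1E.
    + by apply: sigma_braid; rewrite s2E.
    + by apply: sigma_far; rewrite s1E s3E.
  - move=> s1 s2 s1E s2E; rewrite !word_evalE /= (index1E _ s1E).
    by apply: braid_clasp_sigma12; apply: sigma_braid; rewrite s1E.
  - move=> j j_gt2; rewrite !word_evalE /=.
    by apply/commute_sym/commuteX/commute_sym/sigma_far; rewrite /far j_gt2.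
  - move=> s1 s1E; rewrite !word_evalE /= (index1E _ s1E).
    exact/commute_sym/commuteX.
  - move=> s1 s2 s1E s2E; rewrite !word_evalE /= (index1E _ s1E) -mulgA.
    by apply: braid_clasp_twist; apply: sigma_braid; rewrite s1E.
  - by move=> s1 s1E; rewrite !word_evalE /= (index1E _ s1E) mulgK.
apply: (pres_isoP valR sR) => [|y]; last exact: (pres_lift_gen valR).
case=> [i|]; first exact: (pres_lift_gen sR).
(* The round trip sends the clasp generator to the square of [sigma_1]; the relation
   [clasp_p1_resolve], solved for [p1], identifies the two. *)
rewrite /= expg2 (pres_liftM sR) (pres_lift_gen sR).
have /pres_class_rel := clasp_p1_resolve (erefl (val (index1 hn))).
by rewrite pres_classM pres_classV => /(canRL (mulgVK _)).
Qed.
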